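(* Let $a>b\ge0$ be constants. Any algorithm to recover the partition in $\mathrm{GBM}\big(\tfrac{a\log n}{n},\tfrac{b\log n}{n}\big)$ will give incorrect output with probability $1-o(1)$ if $a-b<0.5$ or $a<1$.
   Context: Geometric block model $\mathrm{GBM}(r_s,r_d)$ with $r_s>r_d$: the vertex set is $V=V_1\sqcup V_2$ with $|V_1|=|V_2|=n/2$ (the partition is hidden). Each $u\in V$ receives an independent uniform random number $X_u\in[0,1]$. Vertices $u,v$ are adjacent if and only if $d_L(X_u,X_v)\le r_s$ when $u,v$ lie in the same part, and $d_L(X_u,X_v)\le r_d$ when they lie in different parts, where $d_L(x,y)=\min\{|x-y|,1-|x-y|\}$. Recovering the partition means outputting $\{V_1,V_2\}$ exactly (up to swapping labels) from the graph. $\log$ is natural. *)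

(* Defs.v *)
From HB Require Import structures.
From mathcomp Require Import all_boot all_order all_algebra.
From mathcomp Require Import all_classical all_reals all_analysis.

Set Implicit Arguments.
Unset Strict Implicit.
Unset Printing Implicit Defensive.

Import Order.TTheory GRing.Theory Num.Theory.
Import numFieldNormedType.Exports.

Local Open Scope classical_set_scope.
Local Open Scope ring_scope.

Definition dL (R : realType) (x y : R) : R :=
  Num.min `|x - y| (1 - `|x - y|).

(* A labelled graph on 'I_n, as the symmetric irreflexive set of its ordered
   adjacent pairs. *)
Definition graph (n : nat) : Type := {set 'I_n * 'I_n}.

(* The parts are V1 and its complement, so u and v lie in the same part exactly
   when their membership bits in V1 agree. *)
Definition gbm_graph (R : realType) (n : nat) (rs rd : R) (x : 'I_n -> R)
    (V1 : {set 'I_n}) : graph n :=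
  [set e : 'I_n * 'I_n | (e.1 != e.2) &&
    (dL (x e.1) (x e.2) <=
       (if (e.1 \in V1) == (e.2 \in V1) then rs else rd))]%SET.

(* The unordered partition {V1, V2}: insensitive to swapping the labels. *)
Definition parts (n : nat) (V1 : {set 'I_n}) : {set {set 'I_n}} :=
  [set V1; ~: V1]%SET.

Definition balanced (n : nat) : {set {set 'I_n}} :=
  [set A : {set 'I_n} | #|A|.*2 == n]%SET.

Definition mutual_independence d (T : measurableType d) (R : realType)
    (P : probability T R) (I : finType) (F : I -> set (set T)) : Prop :=
  forall (J : {set I}) (E : I -> set T), (forall i, i \in J -> F i (E i)) ->
    P (\bigcap_(i in [set i | i \in J]) E i) = (\prod_(i in J) P (E i))%E.

(* The events determined by each of the sources of randomness: the n locations,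
   the hidden part (inr true), and the random seed of the algorithm
   (inr false). *)
Definition source_events d (T : measurableType d) (R : realType)
    (P : probability T R) dS (S : measurableType dS) (n : nat)
    (X : 'I_n -> {RV P >-> R}) (V1 : T -> {set 'I_n}) (W : {RV P >-> S})
    (i : 'I_n + bool) : set (set T) :=
  match i with
  | inl u => preimage_set_system setT (X u) measurable
  | inr true => preimage_set_system setT V1 setT
  | inr false => preimage_set_system setT W measurable
  end.

(* The randomness of the geometric block model, together with a seed W for
   the algorithm. "Hidden" means that V1 is uniform among the vertex sets of size
   n / 2 and independent of everything else: a fixed partition could be output
   by a constant algorithm. *)
Record gbm_randomness d (T : measurableType d) (R : realType)
    (P : probability T R) dS (S : measurableType dS) (n : nat)
    (X : 'I_n -> {RV P >-> R}) (V1 : T -> {set 'I_n}) (W : {RV P >-> S})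
    : Prop := GbmRandomness {
  location_uniform : forall (u : 'I_n) (B : set R), measurable B ->
    distribution P (X u) B = uniform_prob (@ltr01 R) B ;
  part_measurable : forall A : {set 'I_n}, measurable (V1 @^-1` [set A]) ;
  part_balanced : forall w, V1 w \in balanced n ;
  part_uniform : forall A : {set 'I_n}, A \in balanced n ->
    P (V1 @^-1` [set A]) = ((#|balanced n|%:R : R)^-1)%:E ;
  sources_independent : mutual_independence P (source_events X V1 W)
}.

(* A randomized algorithm on n-vertex graphs reads the graph and a seed; a
   deterministic one ignores the seed. Its output is an arbitrary family of
   vertex sets. *)
Definition measurable_algorithm dS (S : measurableType dS) (n : nat)
    (A : graph n -> S -> {set {set 'I_n}}) : Prop :=
  forall (G : graph n) (Q : {set {set 'I_n}}), measurable [set s | A G s = Q].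

(* Main.v *)
Require Import Defs.
From HB Require Import structures.
From mathcomp Require Import all_boot all_order all_algebra.
From mathcomp Require Import all_classical all_reals all_analysis.
From mathcomp Require Import measurable_realfun ring lra zify.

Set Implicit Arguments.
Unset Strict Implicit.
Unset Printing Implicit Defensive.

Import Order.TTheory GRing.Theory Num.Theory.
Import numFieldNormedType.Exports.

Local Open Scope classical_set_scope.
Local Open Scope ring_scope.

(* Only the pairs u, v with r_d < d_L(X_u, X_v) <= r_s link the graph to the
   hidden partition, so exchanging the two labels on a connected component of
   this relation does not change the graph. If there are K components, then the
   2^n vertex sets produce at most 2^(n - K) graphs, while there are
   'C(n, n/2) >= 2^n / (n + 1) equally likely values of V1: even an algorithm that
   knows all the locations succeeds with probability at most
   2 (n + 1) / 2^K. It remains to see that K is much larger than log n.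

   Cut [0, 1] into about n / log n disjoint blocks of length of order log n / n.
   If a < 1, an empty interval of length r_s cannot be crossed, and such intervals
   separate components as soon as there is a point between them. If a - b < 1/2,
   a point of a tiny core cell is separated from everything outside its core when
   the two intervals at distance r_d to r_s, of total length about 2 (r_s - r_d),
   are empty. In both cases a given block has the required empty cell with
   probability n^(-c) for some c < 1, disjoint cells are negatively correlated,
   and Chebyshev's inequality gives about n^(1 - c) / log n such blocks; the core
   cell, of length eps log n / n, is also empty in a fraction n^(-eps) of them
   only. *)

(** * Counting the graphs of a colouring *)

(** The hypothesis says that [g] does not notice when all memberships within a colour class are
    flipped, so each value of [g] is attained at a set avoiding one chosen representative per
    colour. *)
Lemma card_imset_twist (I C G : finType) (c : I -> C) (g : {set I} -> G) :
  (forall V V' : {set I},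
     (forall u v, c u = c v ->
        ((u \in V) == (v \in V)) = ((u \in V') == (v \in V'))) ->
     g V = g V') ->
  (#|g @: [set: {set I}]%SET| <= 2 ^ (#|I| - #|c @: [set: I]%SET|))%N.
Proof.
move=> gE.
(* Adding r^-1 V to V modulo 2 removes from V all the chosen representatives. *)
pose r u := odflt u [pick v | c v == c u].
have cr u : c (r u) = c u by rewrite /r; case: pickP => //= v /eqP.
have rc u v : c u = c v -> r u = r v.
  rewrite /r => ->; case: pickP => //= /(_ v).
  by rewrite eqxx.
pose F := [set u | r u == u]%SET.
have leF : (#|c @: [set: I]%SET| <= #|F|)%N.
  apply: leq_trans (leq_imset_card c F); apply: subset_leq_card.
  apply/fintype.subsetP => _ /imsetP[u _ ->]; apply/imsetP; exists (r u) => //.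
  by rewrite inE; apply/eqP/rc.
have sub : (g @: [set: {set I}]%SET \subset g @: powerset (~: F)%SET).
  apply/fintype.subsetP => _ /imsetP[V _ ->]; apply/imsetP.
  exists [set u | (u \in V) (+) (r u \in V)]%SET.
    rewrite inE; apply/fintype.subsetP => u; rewrite !inE.
    by apply: contraL => /eqP ->; rewrite addbb.
  by apply: gE => u v /rc ruv; rewrite !inE ruv;
  case: (u \in V); case: (v \in V); case: (r v \in V).
apply: leq_trans (subset_leq_card sub) _.
apply: leq_trans (leq_imset_card _ _) _.
rewrite card_powerset cardsCs finset.setCK leq_exp2l//.
exact: leq_sub2l.
Qed.

(** For a fixed graph the output is one fixed family, and it can equal [parts V] only for a single
    [V] and its complement. *)
Lemma card_recovered_le (n : nat) (G : finType) (g : {set 'I_n} -> G)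
    (A : G -> {set {set 'I_n}}) :
  (#|[set V | A (g V) == parts V]%SET| <= 2 * #|g @: [set: {set 'I_n}]%SET|)%N.
Proof.
rewrite -sum1_card (partition_big g (mem (g @: [set: {set 'I_n}]%SET))) /=; last first.
  by move=> V _; apply: imset_f.
rewrite mulnC -sum_nat_const; apply: leq_sum => y _.
pose D := [set V | (A (g V) == parts V) && (g V == y)]%SET.
rewrite (eq_bigl (mem D)); last by move=> V; rewrite !inE.
rewrite sum1_card.
have [->|/set0Pn[V VD]] := eqVneq D finset.set0; first by rewrite cards0.
have: (#|D| <= #|parts V|)%N.
  apply: subset_leq_card; apply/fintype.subsetP => V'.
  move: VD; rewrite !inE => /andP[/eqP E1 /eqP gV] /andP[/eqP E2 /eqP gV'].
  have := erefl (parts V'); rewrite -[LHS]E2 gV' -gV E1.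
  rewrite /parts => E.
  by have := setU11 V' [set ~: V']%SET; rewrite -E !inE.
move/leq_trans; apply; rewrite /parts cardsU1 cards1.
by case: (_ \notin _).
Qed.

Lemma card_balanced (m : nat) : #|balanced m.*2| = 'C(m.*2, m).
Proof.
rewrite -[m.*2 in RHS]card_ord -cardsT -cards_draws; apply: eq_card => V.
by rewrite !inE finset.subsetT (inj_eq double_inj).
Qed.

(** Induction on the ratio of consecutive central binomials. The polynomial loss is harmless, being
    beaten by the factor [2 ^ k] later on. *)
Lemma expn2_le_central_bin (m : nat) : (2 ^ m.*2 <= m.*2.+1 * 'C(m.*2, m))%N.
Proof.
elim: m => // m IH.
have E : (m.+1 * 'C(m.+1.*2, m.+1) = 2 * (m.*2.+1 * 'C(m.*2, m)))%N.
  have H1 := mul_bin_diag m.+1.*2 m; rewrite doubleS /= in H1.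
  have H2 := mul_bin_down m.*2.+1 m; rewrite /= in H2.
  rewrite (_ : m.*2.+1 - m = m.+1)%N in H2; last by rewrite -addnn; lia.
  rewrite doubleS -H1 H2 mulnA; congr (_ * _)%N; rewrite -muln2; lia.
rewrite [in (2 ^ _)%N]doubleS 2!expnS.
apply: (@leq_trans (2 * (m.+1 * 'C(m.+1.*2, m.+1)))%N).
  by rewrite E !leq_mul2l IH.
by rewrite mulnA mul2n leq_mul2r leqnSn orbT.
Qed.

(** * Cells separating the vertices *)

Definition empty_cells (R : realType) (n M : nat) (x : 'I_n -> R)
    (E : 'I_M -> set R) : {set 'I_M} :=
  [set k | [forall u, x u \notin E k]]%SET.

(** Left end of the [k]-th block: a core of length [tau] with a margin [rs] on each side. The shift
    [k.+1] keeps the blocks away from 0, where the circle closes up. *)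
Definition cell_start (R : realType) (rs tau : R) (k : nat) : R :=
  k.+1%:R * (rs + rs + tau).

Definition core_cell (R : realType) (rs tau : R) (k : nat) : set R :=
  `[cell_start rs tau k + rs, cell_start rs tau k + rs + tau[.

Definition gap_cell (R : realType) (rs tau : R) (k : nat) : set R :=
  `[cell_start rs tau k, cell_start rs tau k + rs[.

(* The points outside the core that may lie at distance in ]rd, rs] from a point
   of the core. The maximum with tau only matters when rd < tau, in particular
   when rd = 0. *)
Definition annulus_cell (R : realType) (rs rd tau : R) (k : nat) : set R :=
  `[cell_start rs tau k, cell_start rs tau k + rs + tau - Num.max tau rd[ `|`
  `[cell_start rs tau k + rs + Num.max tau rd,
    cell_start rs tau k + (rs + rs + tau)[.

Lemma cell_startS (R : realType) (rs tau : R) (k l : nat) :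
  0 <= rs -> 0 <= tau -> (k < l)%N ->
  cell_start rs tau k + (rs + rs + tau) <= cell_start rs tau l.
Proof.
move=> rs0 tau0 kl; rewrite /cell_start -[X in _ + X]mul1r -mulrDl natr1.
by rewrite ler_wpM2r ?ler_nat//; lra.
Qed.

Lemma cell_start_gt0 (R : realType) (rs tau : R) (k : nat) :
  0 <= rs -> 0 < tau -> 0 < cell_start rs tau k.
Proof. by move=> rs0 tau0; rewrite mulr_gt0 ?ltr0n//; lra. Qed.

Lemma dLC (R : realType) (x y : R) : dL x y = dL y x.
Proof. by rewrite /dL distrC. Qed.

(** A pair at distance in ]rd, rs] is monochromatic, so its same-part bit is unchanged; for any
    other pair both thresholds give the same answer, whatever the partition. *)
Lemma gbm_graph_twist (R : realType) (n : nat) (rs rd : R) (x : 'I_n -> R)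
    (C : Type) (c : 'I_n -> C) (V V' : {set 'I_n}) :
  rd <= rs ->
  (forall u v, rd < dL (x u) (x v) <= rs -> c u = c v) ->
  (forall u v, c u = c v ->
     ((u \in V) == (v \in V)) = ((u \in V') == (v \in V'))) ->
  gbm_graph rs rd x V = gbm_graph rs rd x V'.
Proof.
move=> rdrs cH cV; apply/setP => -[u v]; rewrite !inE /=; congr (_ && _).
have [H|H] := boolP (rd < dL (x u) (x v) <= rs); first by rewrite (cV _ _ (cH _ _ H)).
move: H; rewrite negb_and -leNgt -ltNge => H.
have K (b : bool) :
    (dL (x u) (x v) <= (if b then rs else rd)) = (dL (x u) (x v) <= rd).
  case: b => //; apply/idP/idP => H1; last exact: le_trans H1 rdrs.
  by case/orP: H => // H; move: (lt_le_trans H H1); rewrite ltxx.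
by rewrite !K.
Qed.

(** At least [k] connected components, witnessed by a colouring that is constant on them rather than
    by the components themselves. *)
Definition separated_colours (R : realType) (n : nat) (rs rd : R)
    (x : 'I_n -> R) (k : nat) : Prop :=
  exists (C : finType) (c : 'I_n -> C),
    (forall u v, rd < dL (x u) (x v) <= rs -> c u = c v) /\
    (k <= #|c @: [set: 'I_n]%SET|)%N.

Lemma cell_end_le (R : realType) (M : nat) (rs tau : R) (k : 'I_M) :
  0 <= rs -> 0 <= tau -> M.+1%:R * (rs + rs + tau) <= 1 - rs ->
  cell_start rs tau k + (rs + rs + tau) <= 1 - rs.
Proof.
move=> rs0 tau0; apply: le_trans.
rewrite /cell_start -[X in _ + X]mul1r -mulrDl natr1.
by rewrite ler_wpM2r ?ler_nat ?ltnS ?ltn_ord//; lra.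
Qed.

(** Good blocks, with [E k] empty and [T k] occupied, are encoded as a difference of two families of
    empty cells, because the probability that a cell is empty is an explicit power. *)
Lemma mem_good_cells (R : realType) (n M : nat) (x : 'I_n -> R)
    (E T : 'I_M -> set R) k :
  k \in empty_cells x E :\: empty_cells x (fun k => E k `|` T k) ->
  (forall u, ~ E k (x u)) /\ exists u, T k (x u).
Proof.
rewrite !inE => /andP[/forallPn[u /negPn]]; rewrite inE => xu /forallP H.
have H' v : ~ E k (x v) by have := H v; rewrite notin_setE.
by split=> //; exists u; case: xu => // /H'.
Qed.

(** A point is coloured by the set of good gaps behind it. A step of length at most [rs] cannot jump
    over an empty interval of that length, and the occupied cores just after the good gaps get
    distinct colours. *)
Lemma separated_gap (R : realType) (n M : nat) (rs rd tau : R) (x : 'I_n -> R)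
    (rd_ge0 : 0 <= rd) (rd_rs : rd <= rs) (tau_gt0 : 0 < tau)
    (x01 : forall u, 0 <= x u <= 1)
    (M_le : M.+1%:R * (rs + rs + tau) <= 1 - rs)
    (T := fun k : 'I_M => core_cell rs tau k)
    (E := fun k : 'I_M => gap_cell rs tau k) :
  separated_colours rs rd x
    #|empty_cells x E :\: empty_cells x (fun k => E k `|` T k)|.
Proof.
have rs_ge0 : 0 <= rs by exact: le_trans rd_rs.
have s_end (k : 'I_M) := cell_end_le k rs_ge0 (ltW tau_gt0) M_le.
have sS k l := @cell_startS R rs tau k l rs_ge0 (ltW tau_gt0).
have s_gt0 k := @cell_start_gt0 R rs tau k rs_ge0 tau_gt0.
set s := cell_start rs tau in s_end sS s_gt0 *.
pose good : {set 'I_M} :=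
  (empty_cells x E :\: empty_cells x (fun k => E k `|` T k))%SET.
rewrite -/good.
have gP l : l \in good -> (forall u, ~ E l (x u)) /\ exists u, T l (x u).
  exact: mem_good_cells.
clearbody good.
pose D u := [set k in good | s k + rs <= x u]%SET.
(* On the circle, the points before the first gap and those after the last one
   lie in the same arc. *)
pose c u := if D u == finset.set0 then good else D u.
exists {set 'I_M}, c; split.
  suff H u v : x u <= x v -> dL (x u) (x v) <= rs -> c u = c v.
    move=> u v /andP[_ uv]; have [|/ltW] := leP (x u) (x v) => xuv; first exact: H.
    by symmetry; apply: H => //; rewrite dLC.
  move=> xuv duv.
  have sub : D u \subset D v.
    by apply/fintype.subsetP => k; rewrite !inE => /andP[-> /=]; lra.
  have [E0|ne] := eqVneq (D u) (D v); first by rewrite /c E0.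
  have : D u \proper D v by rewrite finset.properEneq ne sub.
  case/fintype.properP => _ [k]; rewrite !inE => /andP[kg kv]; rewrite kg /= => ku.
  have [Ek _] := gP _ kg.
  have xuk : x u < s k.
    rewrite ltNge; apply/negP => ?; apply: (Ek u).
    rewrite -ltNge in ku; rewrite /E /gap_cell /= in_itv /= -/s; apply/andP; split; lra.
  (* The whole gap [k] lies between the two points, so they can only be close through 0. *)
  have [xu xv] : x u <= rs /\ 1 - rs <= x v.
    move: duv; rewrite /dL ge_min distrC ger0_norm; last lra.
    by have := x01 u; have := x01 v => ? ? /orP[?|?]; split; lra.
  have -> : c u = good.
    rewrite /c ifT//; apply/eqP/setP => l; rewrite !inE; apply/negbTE.
    rewrite negb_and -ltNge; apply/orP; right.
    by have := s_gt0 l; lra.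
  have -> : c v = good.
    rewrite /c; case: ifPn => // _; apply/setP => l; rewrite finset.in_set.
    by case: (l \in good) => //=; have := s_end l; lra.
  by [].
(* The colour of the points of the [k]-th core; for good [k] it determines [k] as its largest
   element. *)
pose d (k : 'I_M) := [set l in good | (l <= k)%N]%SET.
have dinj : {in good &, injective d}.
  move=> k k' kg kg' dk; apply/val_inj/anti_leq/andP; split.
    have : k \in d k by rewrite inE kg leqnn.
    by rewrite dk inE => /andP[].
  have : k' \in d k' by rewrite inE kg' leqnn.
  by rewrite -dk inE => /andP[].
rewrite -(card_in_imset dinj); apply: subset_leq_card.
apply/fintype.subsetP => _ /imsetP[k kg ->].
have [_ [u xu]] := gP _ kg.
apply/imsetP; exists u => //.
have Du : D u = d k.
  apply/setP => l; rewrite !inE; congr (_ && _).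
  move: xu; rewrite /T /core_cell /= in_itv /= -/s => /andP[xu1 xu2].
  have [lk|lk] := leqP l k.
    move: lk; rewrite leq_eqVlt => /orP[/eqP ->//|lk].
    have := sS _ _ lk; lra.
  apply/negbTE; rewrite -ltNge.
  have := sS _ _ lk; lra.
rewrite /c ifF ?Du//; apply/negbTE/set0Pn; exists k.
by rewrite inE kg leqnn.
Qed.

(** A point is coloured by the good core containing it, and by [None] if there is none. A partner of
    a core point at distance in ]rd, rs] and outside the core would lie in the empty annulus
    cell. *)
Lemma separated_annulus (R : realType) (n M : nat) (rs rd tau : R) (x : 'I_n -> R)
    (rd_ge0 : 0 <= rd) (rd_rs : rd <= rs) (tau_gt0 : 0 < tau)
    (x01 : forall u, 0 <= x u <= 1)
    (M_le : M.+1%:R * (rs + rs + tau) <= 1 - rs)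
    (T := fun k : 'I_M => core_cell rs tau k)
    (E := fun k : 'I_M => annulus_cell rs rd tau k) :
  separated_colours rs rd x
    #|empty_cells x E :\: empty_cells x (fun k => E k `|` T k)|.
Proof.
have rs_ge0 : 0 <= rs by exact: le_trans rd_rs.
have s_end (k : 'I_M) := cell_end_le k rs_ge0 (ltW tau_gt0) M_le.
have sS k l := @cell_startS R rs tau k l rs_ge0 (ltW tau_gt0).
have s_gt0 k := @cell_start_gt0 R rs tau k rs_ge0 tau_gt0.
set s := cell_start rs tau in s_end sS s_gt0 *.
pose good : {set 'I_M} :=
  (empty_cells x E :\: empty_cells x (fun k => E k `|` T k))%SET.
rewrite -/good.
have gP l : l \in good -> (forall u, ~ E l (x u)) /\ exists u, T l (x u).
  exact: mem_good_cells.
clearbody good.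
pose c u := [pick k | (k \in good) && (x u \in T k)].
exists (option 'I_M), c; split.
  suff H u v k : rd < dL (x u) (x v) <= rs -> k \in good -> x u \in T k -> x v \in T k.
    move=> u v uv; apply: eq_pick => k; case kg : (k \in good) => //=.
    by apply/idP/idP; apply: H => //; rewrite dLC.
  move=> /andP[uv1 uv2] kg; rewrite !inE.
  have [Ek _] := gP _ kg; have := Ek v.
  rewrite /E /annulus_cell /T /core_cell /= !in_itv /= -/s => Ekv xu.
  have sk := s_gt0 k; have se := s_end k.
  move: uv1 uv2; rewrite /dL lt_min ge_min => /andP[uv1 _] uv2.
  (* The core is further than [rs] from both 0 and 1, so the distance is not realised around the
     circle. *)
  have {uv2} uv2 : `|x u - x v| <= rs.
    case/orP: uv2 => // uv2; exfalso.
    have := x01 u; have := x01 v; move: uv2.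
    by have [?|?] := ger0P (x u - x v); lra.
  apply: contra_notT Ekv => xv; move: uv1 uv2.
  have [t0|t0] := leP tau rd; have [?|?] := ger0P (x u - x v);
    move: xv; rewrite negb_and -ltNge -leNgt => /orP[] ? ? ?;
    solve [exfalso; lra | left; apply/andP; split; lra
          | right; apply/andP; split; lra].
rewrite -(card_imset (mem good) Some_inj); apply: subset_leq_card.
apply/fintype.subsetP => _ /imsetP[k kg ->].
have [_ [u xu]] := gP _ kg.
apply/imsetP; exists u => //.
rewrite /c; case: pickP => [l /andP[lg]|/(_ k)]; last first.
  by rewrite kg /=; move: xu; rewrite -[T k _]inE => ->.
move: xu; rewrite inE /T /core_cell /= !in_itv /= -/s => xk xl.
congr Some; apply/ord_inj; case/andP: xk => ? ?; case/andP: xl => ? ?.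
by case: (ltngtP l k) => // /sS ?; exfalso; lra.
Qed.

Lemma card_recovered_separated (R : realType) (n : nat) (rs rd : R)
    (x : 'I_n -> R) (k : nat) (A : graph n -> {set {set 'I_n}}) :
  rd <= rs -> separated_colours rs rd x k ->
  (#|[set V | A (gbm_graph rs rd x V) == parts V]%SET| * 2 ^ k <= 2 * 2 ^ n)%N.
Proof.
move=> rdrs [C [c [cH kc]]].
have cn : (#|c @: [set: 'I_n]%SET| <= n)%N.
  by rewrite (leq_trans (leq_imset_card _ _))// cardsT card_ord.
rewrite -[X in (_ <= 2 * 2 ^ X)%N](subnK cn) expnD mulnA.
apply: leq_mul; last by rewrite leq_exp2l.
apply: leq_trans (card_recovered_le (gbm_graph rs rd x) A) _.
rewrite leq_mul2l /= -[n in (n - _)%N]card_ord.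
by apply: card_imset_twist => V V'; apply: gbm_graph_twist.
Qed.

(** * Random finite sets *)

Lemma measurable_fin_valued d (T : measurableType d) (F : finType) (Y : T -> F)
    (B : F -> set T) :
  (forall f, measurable (Y @^-1` [set f])) -> (forall f, measurable (B f)) ->
  measurable [set w | B (Y w) w].
Proof.
move=> mY mB.
rewrite (_ : [set w | _] = \bigcup_(f in [set: F]) (Y @^-1` [set f] `&` B f)).
  by apply: fin_bigcup_measurable => // f _; apply: measurableI.
by apply/seteqP; split => [w Bw|w [f _ [/= -> //]]]; exists (Y w).
Qed.

Lemma measurable_set_valued d (T : measurableType d) (I : finType)
    (Y : T -> {set I}) :
  (forall i, measurable [set w | i \in Y w]) ->
  forall s, measurable (Y @^-1` [set s]).
Proof.
move=> mY s.
rewrite (_ : _ @^-1` _ = \bigcap_(i in [set: I])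
    (if i \in s then [set w | i \in Y w] else ~` [set w | i \in Y w])).
  apply: fin_bigcap_measurable => // i _.
  by case: ifP => _ //; apply: measurableC.
apply/seteqP; split => w /=.
  by move=> Yw i _; case: ifPn; rewrite -Yw //= => /negP.
move=> H; apply/setP => i; have := H i Logic.I.
by case: ifPn => _ //= /negP/negbTE.
Qed.

Section FiniteValued.
Context d (T : measurableType d) (R : realType) (P : probability T R).

Lemma fine_probK (A : set T) : measurable A -> (fine (P A))%:E = P A.
Proof. by move=> mA; rewrite fineK// fin_num_measure. Qed.

Lemma fine_prob_ge0 (A : set T) : 0 <= fine (P A).
Proof. by rewrite fine_ge0. Qed.

Lemma fine_prob_partition (F : finType) (Y : T -> F) (B : F -> set T) :
  (forall f, measurable (Y @^-1` [set f])) -> (forall f, measurable (B f)) ->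
  fine (P [set w | B (Y w) w]) = \sum_f fine (P (Y @^-1` [set f] `&` B f)).
Proof.
move=> mY mB; have mYB f : measurable (Y @^-1` [set f] `&` B f) by exact: measurableI.
apply: EFin_inj; rewrite -sumEFin fine_probK; last exact: measurable_fin_valued.
rewrite (eq_bigr (fun f => P (Y @^-1` [set f] `&` B f))); last first.
  by move=> f _; rewrite fine_probK.
rewrite -big_enum fsbig_seq ?enum_uniq// -measure_fin_bigcup//.
- congr (P _); apply/seteqP; split => w /=.
    by move=> Qw; exists (Y w) => //=; rewrite mem_enum.
  by move=> [f _ [/= -> //]].
- by move=> f g _ _ [w [[/= <- _] [<- _]]].
Qed.

Lemma fine_prob_fin_valued (F : finType) (Y : T -> F) (Q : pred F) :
  (forall f, measurable (Y @^-1` [set f])) ->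
  fine (P [set w | Q (Y w)]) = \sum_(f | Q f) fine (P (Y @^-1` [set f])).
Proof.
move=> mY; rewrite (fine_prob_partition (B := fun f => [set _ : T | Q f]) mY); last first.
  by move=> f; case: (Q f); [rewrite set_true|rewrite set_false].
rewrite [RHS]big_mkcond; apply: eq_bigr => f _.
by case: (Q f); [rewrite set_true setIT|rewrite set_false setI0 measure0].
Qed.

(** The sum is the expected number of events [C i] that occur, computed as a finite sum over the
    values of the random index set [Y]. *)
Lemma sum_fine_prob_le (I : finType) (C : I -> set T) (N : R) :
  (forall i, measurable (C i)) ->
  (forall w, #|[set i | w \in C i]%SET|%:R <= N) ->
  \sum_i fine (P (C i)) <= N.
Proof.
move=> mC hN; pose Y w := [set i | w \in C i]%SET.
have mY : forall s, measurable (Y @^-1` [set s]).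
  apply: measurable_set_valued => i.
  rewrite (_ : [set w | _] = C i)//.
  by apply/seteqP; split => w /=; rewrite !inE.
have CE i : fine (P (C i)) =
    \sum_(s : {set I}) (i \in s)%:R * fine (P (Y @^-1` [set s])).
  rewrite (_ : C i = [set w | i \in Y w]); last first.
    by apply/seteqP; split => w /=; rewrite !inE.
  rewrite (fine_prob_fin_valued (fun s : {set I} => i \in s) mY) big_mkcond /=.
  by apply: eq_bigr => s _; case: ifP => _; rewrite ?mul1r ?mul0r.
rewrite (eq_bigr _ (fun i _ => CE i)) exchange_big /=.
apply: (@le_trans _ _ (\sum_(s : {set I}) N * fine (P (Y @^-1` [set s])))).
  apply: ler_sum => s _; rewrite -mulr_suml -natr_sum.
  have [->|/set0P[w <-]] := eqVneq (Y @^-1` [set s]) set0.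
    by rewrite measure0 /= !mulr0.
  rewrite ler_wpM2r ?fine_prob_ge0//; apply: le_trans (hN w); rewrite ler_nat.
  by rewrite -/(Y w) -sum1_card [leqRHS]big_mkcond; apply: leq_sum => i _; case: (_ \in _).
rewrite -mulr_sumr -(fine_prob_fin_valued predT mY).
rewrite (_ : [set w | _] = setT); last by apply/seteqP; split.
by rewrite probability_setT mulr1.
Qed.

End FiniteValued.

Section RandomFiniteSets.
Context d (T : measurableType d) (R : realType) (P : probability T R).
Context (I : finType) (Y : T -> {set I}).
Hypothesis mY : forall i, measurable [set w | i \in Y w].

Let wt (s : {set I}) : R := fine (P (Y @^-1` [set s])).

Let wt_ge0 s : 0 <= wt s. Proof. exact: fine_prob_ge0. Qed.

Let probE (Q : pred {set I}) :
  fine (P [set w | Q (Y w)]) = \sum_(s : {set I}) (Q s)%:R * wt s.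
Proof.
rewrite (fine_prob_fin_valued P Q (measurable_set_valued mY)) big_mkcond /=.
by apply: eq_bigr => s _; case: (Q s); rewrite ?mul1r ?mul0r.
Qed.

Let wt1 : \sum_(s : {set I}) wt s = 1.
Proof.
have := probE predT; rewrite (_ : [set w | _] = setT); last by apply/seteqP; split.
by rewrite probability_setT => /= ->; apply: eq_bigr => s _; rewrite mul1r.
Qed.

Let cardE (s : {set I}) : #|s|%:R = \sum_i (i \in s)%:R :> R.
Proof. by rewrite -sum1_card natr_sum big_mkcond; apply: eq_bigr => i _; case: (_ \in _). Qed.

Let mean : \sum_(s : {set I}) #|s|%:R * wt s = \sum_i fine (P [set w | i \in Y w]).
Proof.
rewrite (eq_bigr _ (fun i _ => probE (fun s : {set I} => i \in s))) exchange_big /=.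
by apply: eq_bigr => s _; rewrite cardE mulr_suml.
Qed.

Let second_moment : \sum_(s : {set I}) #|s|%:R ^+ 2 * wt s =
  \sum_i \sum_j fine (P [set w | (i \in Y w) && (j \in Y w)]).
Proof.
rewrite (eq_bigr _ (fun i _ => eq_bigr _ (fun j _ =>
  probE (fun s : {set I} => (i \in s) && (j \in s))))).
under eq_bigr do rewrite exchange_big.
rewrite exchange_big /=; apply: eq_bigr => s _.
rewrite cardE expr2 mulr_suml mulr_suml; apply: eq_bigr => i _.
rewrite mulr_sumr mulr_suml; apply: eq_bigr => j _.
by case: (_ \in _); case: (_ \in _); rewrite ?mul0r ?mulr0 ?mul1r ?mul0r.
Qed.

(** Markov's inequality. *)
Lemma prob_card_ge (t : R) : 0 < t ->
  fine (P [set w | t <= #|Y w|%:R]) <= (\sum_i fine (P [set w | i \in Y w])) / t.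
Proof.
move=> t0; rewrite (probE (fun s : {set I} => t <= #|s|%:R)) -mean ler_pdivlMr// mulr_suml.
apply: ler_sum => s _; rewrite mulrAC ler_wpM2r//.
by case: (leP t #|s|%:R) => ts; rewrite /= ?mul1r ?mul0r.
Qed.

(** Chebyshev's inequality: since pairs are not positively correlated, the variance of [#|Y w|] is
    at most its mean. *)
Lemma prob_card_lt_half (p : R) : 0 < #|I|%:R * p ->
  (forall i, fine (P [set w | i \in Y w]) = p) ->
  (forall i j, i != j ->
     fine (P [set w | (i \in Y w) && (j \in Y w)]) <= p ^+ 2) ->
  fine (P [set w | #|Y w|%:R < #|I|%:R * p / 2]) <= 4 / (#|I|%:R * p).
Proof.
set y := #|I|%:R * p => y0 Pi Pij.
have m1 : \sum_(s : {set I}) #|s|%:R * wt s = y.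
  by rewrite mean (eq_bigr _ (fun i _ => Pi i)) sumr_const /y mulr_natl.
have m2 : \sum_(s : {set I}) #|s|%:R ^+ 2 * wt s <= y + y ^+ 2.
  rewrite second_moment.
  have -> : y + y ^+ 2 = \sum_(i : I) (p + \sum_(j : I) p ^+ 2).
    have S (c : R) : \sum_(i : I) c = #|I|%:R * c by rewrite sumr_const mulr_natl.
    rewrite big_split /= !S /y; ring.
  apply: ler_sum => i _; rewrite (bigD1 i)//= (_ : [set w | _] = [set w | i \in Y w]).
    rewrite Pi lerD2l [leRHS](bigD1 i)//=; apply: le_trans (_ : _ <= 0 + _) _.
      by rewrite add0r; apply: ler_sum => j ji; apply: Pij; rewrite eq_sym.
    by rewrite lerD2r sqr_ge0.
  by apply/seteqP; split => w /=; rewrite andbb.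
rewrite (probE (fun s : {set I} => #|s|%:R < y / 2)).
(* The indicator of [#|s| < y / 2] is at most [4 / y ^+ 2 * (#|s| - y) ^+ 2]. *)
apply: (@le_trans _ _ (\sum_(s : {set I}) (4 / y ^+ 2 * (#|s|%:R - y) ^+ 2) * wt s)).
  apply: ler_sum => s _; rewrite ler_wpM2r//.
  case: (ltP #|s|%:R (y / 2)) => /= [sy|_]; last first.
    by rewrite mulr_ge0 ?sqr_ge0// divr_ge0// sqr_ge0.
  rewrite mulrAC ler_pdivlMr ?exprn_gt0// mul1r.
  have : 0 <= (#|s|%:R : R) by [].
  nra.
have -> : \sum_(s : {set I}) (4 / y ^+ 2 * (#|s|%:R - y) ^+ 2) * wt s =
    4 / y ^+ 2 * (\sum_(s : {set I}) #|s|%:R ^+ 2 * wt s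
                  - 2 * y * (\sum_(s : {set I}) #|s|%:R * wt s)
                  + y ^+ 2 * \sum_(s : {set I}) wt s).
  rewrite !mulr_sumr -sumrN -!big_split /= mulr_sumr; apply: eq_bigr => s _; ring.
rewrite m1 wt1.
apply: (@le_trans _ _ (4 / y ^+ 2 * y)); first by rewrite ler_wpM2l ?divr_ge0 ?sqr_ge0//; lra.
have K (z : R) : 0 < z -> 4 / z ^+ 2 * z = 4 / z by move=> z0; field; rewrite gt_eqF.
by rewrite K.
Qed.

End RandomFiniteSets.

(** * The geometric block model *)

(** Restricting [P] to [D] and scaling [P] by [P D] give two finite measures that agree on a
    pi-system containing the whole space. *)
Lemma prob_setI_g_sigma_algebra d (T : measurableType d) (R : realType)
    (P : probability T R) (G : set (set T)) (D : set T) :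
  measurable D -> G `<=` measurable -> setI_closed G -> G setT ->
  (forall C, G C -> P (D `&` C) = (P D * P C)%E) ->
  forall C, <<s G >> C -> P (D `&` C) = (P D * P C)%E.
Proof.
move=> mD Gm GI GT GP C sC.
pose r : {nonneg R} := NngNum (fine_ge0 (measure_ge0 P D)).
have rE : (r%:num%:E = P D)%E by rewrite /= fineK// fin_num_measure.
transitivity (mrestr P mD C); first by rewrite /mrestr setIC.
rewrite -rE; transitivity (mscale r P C) => //.
apply: (@g_sigma_algebra_measure_unique _ R T G Gm (fun=> setT)) => //.
- by apply/seteqP; split => // w _; exists 0%N.
- by move=> B GB; rewrite /= /mrestr /mscale /= rE setIC; apply: GP.
- by move=> _; rewrite /= /mrestr setTI ltey_eq fin_num_measure.
Qed.

(** * Measurability of the graph and of the empty cells, over an arbitrary sigma-algebra *)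

Section MeasurableGraph.
Context d (T : measurableType d) (R : realType) dS (S : measurableType dS).
Context (n : nat) (X : 'I_n -> T -> R) (W : T -> S).
Hypotheses (mX : forall u, measurable_fun [set: T] (X u))
           (mW : measurable_fun [set: T] W).

Lemma measurable_recovered (rs rd : R) (A : graph n -> S -> {set {set 'I_n}})
    (V : {set 'I_n}) (Q : {set {set 'I_n}}) :
  measurable_algorithm A ->
  measurable [set w | A (gbm_graph rs rd (fun u => X u w) V) (W w) = Q].
Proof.
move=> mA; apply: (measurable_fin_valued (Y := fun w => gbm_graph rs rd (X^~ w) V)
  (B := fun G => W @^-1` [set s | A G s = Q])); last first.
  by move=> G; rewrite -[X in measurable X]setTI; apply: mW => //; exact: mA.
apply: measurable_set_valued => -[u v].
rewrite (_ : [set w | _] = [set w | u != v] `&`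
    [set w | dL (X u w) (X v w) <= (if (u \in V) == (v \in V) then rs else rd)]).
  apply: measurableI.
    by case: (u != v); [rewrite set_true|rewrite set_false].
  pose c := if (u \in V) == (v \in V) then rs else rd; rewrite -/c.
  rewrite (_ : [set w | _] = setT `&` (fun w => dL (X u w) (X v w)) @^-1` `]-oo, c]).
    have md : measurable_fun [set: T] (fun w => dL (X u w) (X v w)).
      have mn : measurable_fun [set: T] (fun w => `|X u w - X v w|).
        by apply: measurableT_comp => //; apply: measurable_funB.
      by apply: measurable_minr => //; apply: measurable_funB.
    by apply: md.
  by rewrite setTI; apply/seteqP; split => w /=; rewrite in_itv.
by apply/seteqP; split => w /=; rewrite inE /= => /andP.
Qed.

Lemma measurable_empty_cells (M : nat) (E : 'I_M -> set R) (k : 'I_M) :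
  measurable (E k) -> measurable [set w | k \in empty_cells (X^~ w) E].
Proof.
move=> mE; rewrite (_ : [set w | _] = \bigcap_(u in [set: 'I_n]) ~` (X u @^-1` E k)).
  apply: fin_bigcap_measurable => // u _; apply: measurableC.
  by rewrite -[X in measurable X]setTI; exact: mX.
apply/seteqP; split => w /=.
  by rewrite inE => /forallP H u _; have := H u; rewrite notin_setE.
by move=> H; rewrite inE; apply/forallP => u; rewrite notin_setE; exact: H.
Qed.

End MeasurableGraph.

Lemma fine_prob_leU d (T : measurableType d) (R : realType) (P : probability T R)
    (A B C : set T) :
  measurable A -> measurable B -> measurable C -> A `<=` B `|` C ->
  fine (P A) <= fine (P B) + fine (P C).
Proof.
move=> mA mB mC ABC; rewrite -lee_fin EFinD !fine_probK//.
apply: le_trans (measureU2 _ mB mC); apply: le_measure => //; rewrite inE//.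
exact: measurableU.
Qed.

Lemma fine_uniform_itv (R : realType) (x y : R) :
  0 <= x -> x <= y -> y <= 1 ->
  fine (uniform_prob (@ltr01 R) `[x, y[) = y - x.
Proof.
move=> x0 xy y1; rewrite /uniform_prob (eq_integral (fun=> 1%:E)); last first.
  move=> z; rewrite inE /= in_itv /= => /andP[xz zy].
  by rewrite /uniform_pdf subr0 invr1 ifT//; apply/andP; split; lra.
rewrite integral_cst//= lebesgue_measure_itv /= lte_fin mul1e.
case: ltP => [_|yx]; first by rewrite -EFinB.
by rewrite (_ : y = x) ?subrr//; apply/eqP; rewrite eq_le yx xy.
Qed.

Lemma fine_uniformU (R : realType) (A B : set R) :
  measurable A -> measurable B -> A `&` B = set0 ->
  fine (uniform_prob (@ltr01 R) (A `|` B)) =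
    fine (uniform_prob (@ltr01 R) A) + fine (uniform_prob (@ltr01 R) B).
Proof.
move=> mA mB AB; rewrite measureU// fineD//; exact: fin_num_measure.
Qed.

Section GBM.
Context d (T : measurableType d) (R : realType) (P : probability T R).
Context dS (S : measurableType dS) (n : nat).
Context (X : 'I_n -> {RV P >-> R}) (V1 : T -> {set 'I_n}) (W : {RV P >-> S}).
Hypothesis model : gbm_randomness X V1 W.

Let src := source_events X V1 W.

(* The finite intersections of events determined by a single location or by the
   seed. *)
Definition location_seed_events : set (set T) :=
  [set C | exists2 F : 'I_n + bool -> set T,
     (forall i, i != inr true -> src i (F i)) &
     C = \bigcap_(i in [set i | i \in [set~ inr true]%SET]) F i].

Let sgT := g_sigma_algebraType location_seed_events.

Let src_setT i : src i setT.
Proof. by case: i => [u|[]]; exists setT => //=; rewrite preimage_setT setTI. Qed.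

Let src_measurable i A : src i A -> measurable A.
Proof.
case: i => [u|[]] [B mB <-]; rewrite setTI.
- by rewrite -[X in measurable X]setTI; apply: measurable_funPT.
- rewrite (_ : V1 @^-1` B = \bigcup_(V in B) (V1 @^-1` [set V])).
    apply: fin_bigcup_measurable; first exact: finite_finset.
    by move=> V _; apply: (part_measurable model).
  by apply/seteqP; split => [w Bw|w [V BV /= ->]] //; exists (V1 w).
- by rewrite -[X in measurable X]setTI; apply: measurable_funPT.
Qed.

Let src_setI i A B : src i A -> src i B -> src i (A `&` B).
Proof.
case: i => [u|[]] [A' mA <-] [B' mB <-]; exists (A' `&` B');
  rewrite ?setTI ?preimage_setI//; exact: measurableI.
Qed.

Let lse_setI : setI_closed location_seed_events.
Proof.
move=> _ _ [F sF ->] [F' sF' ->]; exists (fun i => F i `&` F' i).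
  by move=> i ii; apply: src_setI; [apply: sF|apply: sF'].
by rewrite bigcapI.
Qed.

Let lse_src i A : i != inr true -> src i A -> location_seed_events A.
Proof.
move=> ii sA; exists (fun j => if j == i then A else setT).
  by move=> j _; case: eqP => [->|_].
apply/seteqP; split => w /=.
  by move=> Aw j _; case: eqP.
by move=> /(_ i); rewrite /= !inE eqxx => /(_ ii).
Qed.

Let lse_measurable : location_seed_events `<=` measurable.
Proof.
move=> _ [F sF ->]; apply: fin_bigcap_measurable; first exact: finite_finset.
by move=> i /=; rewrite !inE => ii; apply: src_measurable (sF i ii).
Qed.

(** On the generating pi-system, compare the product formula over all sources with the one over all
    sources but the hidden part. *)
Lemma part_independent (V : {set 'I_n}) (C : set T) :
  <<s location_seed_events >> C ->
  P (V1 @^-1` [set V] `&` C) = (P (V1 @^-1` [set V]) * P C)%E.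
Proof.
apply: prob_setI_g_sigma_algebra => //.
- exact: (part_measurable model).
- by apply: (@lse_src (inr false)).
move=> _ [F sF ->]; set J := [set~ inr true]%SET.
pose E i := if i == inr true then V1 @^-1` [set V] else F i.
have sE i : src i (E i).
  rewrite /E; case: eqP => [->|/eqP ii]; last exact: sF.
  by exists [set V] => //; rewrite setTI.
have EJ i : i \in J -> E i = F i by rewrite !inE /E => /negbTE ->.
have indep := sources_independent model.
have := indep [set: 'I_n + bool]%SET E (fun i _ => sE i).
rewrite (bigD1 (inr true)) /= ?inE//.
rewrite (_ : E (inr true) = V1 @^-1` [set V]); last by rewrite /E eqxx.
rewrite (eq_bigl (mem J)); last by move=> i; rewrite !inE.
rewrite -(indep J E (fun i _ => sE i)) (eq_bigcapr EJ) => <-.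
congr (P _); apply/seteqP; split => w /=.
  move=> [Vw Fw] i _; rewrite /E; case: eqP => // /eqP ii.
  by apply: Fw; rewrite /= !inE.
move=> H; split; first by have := H (inr true); rewrite /= /E eqxx inE; apply.
by move=> i /= iJ; rewrite -EJ//; apply: H; rewrite /= inE.
Qed.

Let measurable_X_sg u : measurable_fun [set: sgT] (X u : sgT -> R).
Proof.
move=> _ B mB; apply: sub_sigma_algebra; apply: (@lse_src (inl u)) => //.
by exists B.
Qed.

Let measurable_W_sg : measurable_fun [set: sgT] (W : sgT -> S).
Proof.
move=> _ B mB; apply: sub_sigma_algebra; apply: (@lse_src (inr false)) => //.
by exists B.
Qed.

Let sg_measurable A : <<s location_seed_events >> A -> measurable A.
Proof. by apply: smallest_sub => //; exact: sigma_algebra_measurable. Qed.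

(** Condition on the hidden part: each balanced [V] has the same weight and is independent of the
    event that [V] would be recovered, which depends on locations and seed only. At each outcome in
    [Good], few [V] would be recovered. *)
Lemma prob_recovered_le (rs rd : R) (k : nat)
    (A : graph n -> S -> {set {set 'I_n}}) (Good : set T) :
  measurable_algorithm A -> rd <= rs ->
  <<s location_seed_events >> Good ->
  (forall w, Good w -> separated_colours rs rd (fun u => X u w) k) ->
  fine (P ([set w | A (gbm_graph rs rd (fun u => X u w) (V1 w)) (W w)
                    = parts (V1 w)] `&` Good))
    <= 2 * 2 ^+ n / 2 ^+ k / #|balanced n|%:R.
Proof.
move=> mA rdrs mG sep.
pose C V := [set w | A (gbm_graph rs rd (fun u => X u w) V) (W w) = parts V] `&` Good.
have sC V : <<s location_seed_events >> (C V).
  apply: (@measurableI _ sgT) => //.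
  exact: (@measurable_recovered _ sgT).
have mC V : measurable (C V) by apply: sg_measurable.
rewrite (_ : _ `&` _ = [set w | C (V1 w) w]); last by apply/seteqP; split.
rewrite (fine_prob_partition P (part_measurable model) mC).
apply: (@le_trans _ _ (\sum_V #|balanced n|%:R^-1 * fine (P (C V)))).
  apply: ler_sum => V _; rewrite part_independent//.
  rewrite fineM ?fin_num_measure//; last exact: (part_measurable model).
  have [Vb|Vb] := boolP (V \in balanced n); first by rewrite (part_uniform model).
  rewrite (_ : V1 @^-1` [set V] = set0) ?measure0 ?mul0r ?mulr_ge0 ?fine_prob_ge0//.
  apply/seteqP; split => // w /= Vw.
  by move: Vb; rewrite -Vw (part_balanced model).
rewrite -mulr_sumr mulrC ler_wpM2r// sum_fine_prob_le// => w.
have [Gw|nGw] := pselect (Good w); last first.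
  rewrite (_ : [set V | w \in C V]%SET = finset.set0) ?cards0 ?divr_ge0 ?mulr_ge0 ?exprn_ge0//.
  by apply/setP => V; rewrite !inE; apply/negbTE/negP; rewrite inE => -[].
rewrite ler_pdivlMr ?exprn_gt0// -!natrX -!natrM ler_nat.
apply: leq_trans (card_recovered_separated (A^~ (W w)) rdrs (sep w Gw)).
rewrite leq_mul2r subset_leq_card ?orbT//; apply/fintype.subsetP => V.
by rewrite !inE => -[/= -> _].
Qed.

Lemma prob_all_notin (B : set R) : measurable B ->
  fine (P [set w | forall u, ~ B (X u w)]) = (1 - fine (uniform_prob (@ltr01 R) B)) ^+ n.
Proof.
move=> mB; pose J := [set inl u | u : 'I_n]%SET : {set 'I_n + bool}.
pose E (i : 'I_n + bool) := if i is inl u then X u @^-1` (~` B) else setT.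
have sE i : src i (E i).
  case: i => [u|b]; last exact: src_setT.
  by exists (~` B); [exact: measurableC|rewrite setTI].
have indep := sources_independent model.
have := indep J E (fun i _ => sE i).
rewrite (_ : \bigcap_(i in _) _ = [set w | forall u, ~ B (X u w)]); last first.
  apply/seteqP; split => w /=.
    by move=> H u; apply: (H (inl u)) => /=; apply: imset_f.
  by move=> H i /= /imsetP[u _ ->]; apply: H.
move=> ->; rewrite big_imset /=; last by move=> u v _ _ [].
rewrite (eq_bigr (fun=> (1 - fine (uniform_prob (@ltr01 R) B))%:E)); last first.
  move=> u _; transitivity (distribution P (X u) (~` B)) => //.
  rewrite (location_uniform model)//; last exact: measurableC.
  rewrite probability_setC// EFinB fineK//; exact: fin_num_measure.
by rewrite prodEFin /= prodr_const card_ord.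
Qed.

Lemma measurable_correct (rs rd : R) (A : graph n -> S -> {set {set 'I_n}}) :
  measurable_algorithm A ->
  measurable [set w | A (gbm_graph rs rd (fun u => X u w) (V1 w)) (W w)
                      = parts (V1 w)].
Proof.
move=> mA; apply: (measurable_fin_valued (B := fun V =>
  [set w | A (gbm_graph rs rd (fun u => X u w) V) (W w) = parts V])).
  exact: (part_measurable model).
by move=> V; apply: measurable_recovered => // u; exact: measurable_funPT.
Qed.

(** Union bound over four events: too few empty cells (Chebyshev), too many blocks whose core is
    empty as well (Markov), a location outside [0, 1] (null), and a correct output despite [y / 4]
    good blocks. *)
Lemma prob_correct_le (rs rd tau q : R) (M k : nat) (E : 'I_M -> set R)
    (A : graph n -> S -> {set {set 'I_n}})
    (y := M%:R * (1 - q) ^+ n)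
    (EC := fun k : 'I_M => E k `|` core_cell rs tau k) :
  measurable_algorithm A -> rd <= rs -> 0 <= q -> 0 <= tau -> q + tau <= 1 ->
  q + q <= 1 ->
  (forall k, measurable (E k)) ->
  (forall k, fine (uniform_prob (@ltr01 R) (E k)) = q) ->
  (forall k, fine (uniform_prob (@ltr01 R) (EC k)) = q + tau) ->
  (forall k l, k != l -> fine (uniform_prob (@ltr01 R) (E k `|` E l)) = q + q) ->
  (forall x : 'I_n -> R, (forall u, 0 <= x u <= 1) ->
     separated_colours rs rd x #|empty_cells x E :\: empty_cells x EC|) ->
  0 < y -> k%:R <= y / 4 ->
  fine (P [set w | A (gbm_graph rs rd (fun u => X u w) (V1 w)) (W w)
                   = parts (V1 w)])
    <= 4 / y + 4 * (1 - tau) ^+ n + 2 * 2 ^+ n / 2 ^+ k / #|balanced n|%:R.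
Proof.
move=> mA rdrs q0 tau0 qtau qq mE volE volEC volEE sep y0 ky.
pose Y w := empty_cells (fun u => X u w) E.
pose Z w := empty_cells (fun u => X u w) EC.
have mEC l : measurable (EC l) by apply: measurableU => //; exact: measurable_itv.
have mY : forall l, measurable [set w | l \in Y w].
  by move=> l; apply: measurable_empty_cells => // u; exact: measurable_funPT.
have mZ : forall l, measurable [set w | l \in Z w].
  by move=> l; apply: measurable_empty_cells => // u; exact: measurable_funPT.
have YE l : [set w | l \in Y w] = [set w | forall u, ~ E l (X u w)].
  apply/seteqP; split => w /=; rewrite inE.
    by move=> /forallP H u; have := H u; rewrite notin_setE.
  by move=> H; apply/forallP => u; rewrite notin_setE.
have ZE l : [set w | l \in Z w] = [set w | forall u, ~ EC l (X u w)].
  apply/seteqP; split => w /=; rewrite inE.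
    by move=> /forallP H u; have := H u; rewrite notin_setE.
  by move=> H; apply/forallP => u; rewrite notin_setE.
pose few := [set w | #|Y w|%:R < #|'I_M|%:R * (1 - q) ^+ n / 2].
pose many := [set w | y / 4 <= #|Z w|%:R].
(* The locations lie in [0, 1] only almost surely; the double complement fits [prob_all_notin]. *)
pose inside := [set w | forall u, ~ (~` `[0, 1]%classic) (X u w)].
pose enough := [set w | y / 4 <= #|Y w :\: Z w|%:R].
have card_measurable d' (T' : measurableType d') (Q : T' -> {set 'I_M}) (B : pred nat) :
    (forall l, measurable [set w | l \in Q w]) -> measurable [set w | B #|Q w|].
  move=> mQ; apply: (measurable_fin_valued (B := fun s : {set 'I_M} => [set _ | B #|s|])).
    exact: measurable_set_valued.
  by move=> s; case: (B _); [rewrite set_true|rewrite set_false].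
have mfew : measurable few.
  exact: (card_measurable _ _ Y (fun c => c%:R < #|'I_M|%:R * (1 - q) ^+ n / 2)).
have mmany : measurable many.
  exact: (card_measurable _ _ Z (fun c => y / 4 <= c%:R)).
have sinside : <<s location_seed_events >> inside.
  rewrite (_ : inside = \bigcap_(u in [set: 'I_n]) X u @^-1` `[0, 1]%classic).
    apply: (@fin_bigcap_measurable _ sgT) => // u _.
    rewrite -[X in measurable X]setTI; exact: (measurable_X_sg u).
  apply/seteqP; split => w /=; first by move=> H u _; apply: contrapT; exact: H.
  by move=> H u /(_ (H u Logic.I)).
have senough : <<s location_seed_events >> enough.
  apply: (card_measurable _ sgT (fun w => Y w :\: Z w)%SET (fun c => y / 4 <= c%:R)) => l.
  rewrite (_ : [set w | _] = [set w | l \in Y w] `\` [set w | l \in Z w]).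
    apply: (@measurableD _ sgT).
      exact: (@measurable_empty_cells _ sgT).
    exact: (@measurable_empty_cells _ sgT).
  apply/seteqP; split => w /=; rewrite finset.in_setD; first by move=> /andP[/negP].
  by move=> [-> /negP ->].
have sgood : <<s location_seed_events >> (inside `&` enough).
  exact: (@measurableI _ sgT).
have minside := sg_measurable sinside.
set correct := [set w | _].
have mcorrect : measurable correct by exact: measurable_correct.
have mcg : measurable (correct `&` (inside `&` enough)).
  by apply: measurableI => //; exact: sg_measurable.
have Pout : fine (P (~` inside)) = 0.
  rewrite probability_setC//; have mI : measurable (~` `[0, 1]%classic : set R).
    by apply: measurableC; exact: measurable_itv.
  rewrite fineB ?fin_num_measure// (prob_all_notin mI) probability_setC ?measurable_itv//.
  rewrite [X in (1 - fine (1 - X)%E)](_ : _ = 1%E); last exact: integral_uniform_pdf1.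
  by rewrite subee// subr0 expr1n subrr.
have Pfew : fine (P few) <= 4 / y.
  have -> : y = #|'I_M|%:R * (1 - q) ^+ n by rewrite card_ord.
  apply: (prob_card_lt_half mY) => //.
  - by rewrite card_ord.
  - by move=> l; rewrite YE prob_all_notin// volE.
  move=> l l' ll'; rewrite (_ : [set w | _] = [set w | forall u, ~ (E l `|` E l') (X u w)]).
    rewrite prob_all_notin; last exact: measurableU.
    (* Negative correlation of disjoint cells: [1 - (q + q) <= (1 - q) ^+ 2]. *)
    rewrite volEE// -exprM mulnC exprM; apply: lerXn2r; rewrite ?nnegrE ?sqr_ge0//; nra.
  rewrite (_ : [set w | _] = [set w | l \in Y w] `&` [set w | l' \in Y w]); last first.
    by apply/seteqP; split => w /= => [/andP|[-> ->]].
  rewrite !YE; apply/seteqP; split => w /= => [[H H'] u [?|?]|H].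
  - exact: (H u).
  - exact: (H' u).
  - by split => u Eu; apply: (H u); [left|right].
have Pmany : fine (P many) <= 4 * (1 - tau) ^+ n.
  apply: le_trans (prob_card_ge P mZ _) _; first by rewrite divr_gt0.
  rewrite (eq_bigr (fun=> (1 - (q + tau)) ^+ n)); last first.
    by move=> l _; rewrite ZE prob_all_notin// volEC.
  rewrite sumr_const card_ord -[X in X / _]mulr_natl ler_pdivrMr ?divr_gt0//.
  (* The bound then follows from [1 - (q + tau) <= (1 - q) * (1 - tau)]. *)
  rewrite (_ : _ * (y / 4) = M%:R * ((1 - q) * (1 - tau)) ^+ n); last first.
    by rewrite exprMn /y; field.
  rewrite ler_wpM2l//; apply: lerXn2r; rewrite ?nnegrE; nra.
have Pgood := prob_recovered_le mA rdrs sgood.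
apply: le_trans (fine_prob_leU P mcorrect (measurableU _ _ mfew mmany)
  (measurableU _ _ (measurableC minside) mcg) _) _.
  move=> w cw.
  have [wi|wi] := pselect (inside w); last by right; left.
  have [wf|wf] := pselect (few w); first by left; left.
  have [wm|wm] := pselect (many w); first by left; right.
  right; right; split => //; split => //.
  move: wf wm => /negP; rewrite -leNgt card_ord -/y => wf /negP; rewrite -ltNge => wm.
  have : (#|Y w| <= #|Y w :\: Z w| + #|Z w|)%N.
    by rewrite -(cardsID (Z w) (Y w)) addnC leq_add2l subset_leq_card// finset.subsetIr.
  by rewrite -(ler_nat R) natrD /enough /=; lra.
rewrite lerD//.
  apply: le_trans (fine_prob_leU P _ mfew mmany (@subset_refl _ _)) _; first exact: measurableU.
  exact: lerD.
apply: le_trans (fine_prob_leU P _ (measurableC minside) mcg (@subset_refl _ _)) _.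
  by apply: measurableU => //; exact: measurableC.
rewrite Pout add0r; apply: Pgood => w [wi we].
have [C [c [cH cn]]] : separated_colours rs rd (fun u => X u w) #|Y w :\: Z w|.
  by apply: sep => u; have := wi u => /= /contrapT; rewrite /= in_itv.
exists C, c; split => //; apply: leq_trans cn.
by rewrite -(ler_nat R); apply: le_trans ky we.
Qed.

End GBM.

(** The boolean [gap] selects the regime. Cells of different blocks are disjoint and inside [0, 1],
    so lengths add up; an annulus cell consists of two intervals of equal length. *)
Lemma uniform_cells (R : realType) (M : nat) (rs rd tau : R) (gap : bool)
    (E := fun k : 'I_M => if gap then gap_cell rs tau k else annulus_cell rs rd tau k)
    (q := if gap then rs else 2 * (rs + tau - Num.max tau rd))
    (vol := fun B : set R => fine (uniform_prob (@ltr01 R) B)) :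
  0 <= rd -> rd <= rs -> 0 < tau -> M.+1%:R * (rs + rs + tau) <= 1 - rs ->
  (forall k, measurable (E k)) /\
  (forall k, vol (E k) = q) /\
  (forall k, vol (E k `|` core_cell rs tau k) = q + tau) /\
  (forall k l, k != l -> vol (E k `|` E l) = q + q).
Proof.
move=> rd0 rdrs tau0 M_le.
have rs0 := le_trans rd0 rdrs.
have s_end (k : 'I_M) := cell_end_le k rs0 (ltW tau0) M_le.
have sS k l := @cell_startS R rs tau k l rs0 (ltW tau0).
have s_gt0 k := @cell_start_gt0 R rs tau k rs0 tau0.
have mxt : tau <= Num.max tau rd by rewrite le_max lexx.
have mxd : rd <= Num.max tau rd by rewrite le_max lexx orbT.
have mxs : Num.max tau rd <= rs + tau by rewrite ge_max; apply/andP; split; lra.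
have mE k : measurable (E k).
  rewrite /E /gap_cell /annulus_cell; case: gap {E q}; first exact: measurable_itv.
  by apply: measurableU; exact: measurable_itv.
have volE k : vol (E k) = q.
  have := s_gt0 k; have := s_end k.
  rewrite /E /q /vol /gap_cell /annulus_cell; case: gap {E q mE} => ? ?.
    by rewrite fine_uniform_itv//; lra.
  rewrite fine_uniformU; [|exact: measurable_itv|exact: measurable_itv|].
    by rewrite !fine_uniform_itv; lra.
  apply/seteqP; split => // z [/=]; rewrite !in_itv /= => /andP[? ?] /andP[? ?].
  by lra.
have Eblock k z : E k z -> cell_start rs tau k <= z < cell_start rs tau k + (rs + rs + tau).
  rewrite /E /gap_cell /annulus_cell; case: gap {E q mE volE} => /=.
    by rewrite in_itv /= => /andP[? ?]; apply/andP; split; lra.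
  by case; rewrite in_itv /= => /andP[? ?]; apply/andP; split; lra.
split=> //; split=> //; split=> [k|k l kl].
  rewrite /vol fine_uniformU; [|exact: mE|exact: measurable_itv|].
    have := s_gt0 k; have := s_end k => ? ?.
    by rewrite -/(vol _) volE fine_uniform_itv//; lra.
  rewrite /E /gap_cell /annulus_cell /core_cell; apply/seteqP; split => // z [].
  case: gap {E q mE volE Eblock} => /=; rewrite !in_itv /=.
    by move=> /andP[? ?] /andP[? ?]; lra.
  by case => /andP[? ?] /andP[? ?]; lra.
rewrite /vol fine_uniformU// -/(vol _) -/(vol _) ?volE//.
apply/seteqP; split => // z [/Eblock /andP[? ?] /Eblock /andP[? ?]].
by case: (ltngtP k l) => [/sS ?|/sS ?|/ord_inj kE]; [lra|lra|rewrite kE eqxx in kl].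
Qed.

Lemma prob_correct_cells_le d (T : measurableType d) (R : realType)
    (P : probability T R) dS (S : measurableType dS) (m : nat)
    (X : 'I_m.*2 -> {RV P >-> R}) (V1 : T -> {set 'I_m.*2}) (W : {RV P >-> S})
    (A : graph m.*2 -> S -> {set {set 'I_m.*2}})
    (rs rd tau : R) (M k : nat) (gap : bool)
    (q := if gap then rs else 2 * (rs + tau - Num.max tau rd))
    (y := M%:R * (1 - q) ^+ m.*2) :
  gbm_randomness X V1 W -> measurable_algorithm A ->
  0 <= rd -> rd <= rs -> 0 < tau -> M.+1%:R * (rs + rs + tau) <= 1 - rs ->
  0 < y -> k%:R <= y / 4 ->
  fine (P [set w | A (gbm_graph rs rd (fun u => X u w) (V1 w)) (W w)
                   = parts (V1 w)])
    <= 4 / y + 4 * (1 - tau) ^+ m.*2 + 2 * m.*2.+1%:R / 2 ^+ k.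
Proof.
move=> model mA rd0 rdrs tau0 M_le y0 ky.
have rs0 := le_trans rd0 rdrs.
(* Positivity of [y] forces a block to exist, so two block lengths fit in [0, 1]; this yields the
   smallness conditions on [q]. *)
have M1 : 1 <= M%:R :> R.
  rewrite -[1]/(1%:R) ler_nat lt0n; apply/eqP => M0.
  by move: y0; rewrite /y M0 mul0r ltxx.
have small : 2 * (rs + rs + tau) <= 1.
  apply: le_trans (_ : _ <= 1 - rs) _; last lra.
  by apply: le_trans M_le; rewrite -natr1 ler_wpM2r; lra.
have [mE [volE [volEC volEE]]] := uniform_cells gap rd0 rdrs tau0 M_le.
have mxt : tau <= Num.max tau rd by rewrite le_max lexx.
have mxs : Num.max tau rd <= rs + tau by rewrite ge_max; apply/andP; split; lra.
apply: le_trans (prob_correct_le model mA rdrs _ (ltW tau0) _ _ mE volE volEC volEE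
  _ y0 ky) _.
- by rewrite /q; case: gap {q y y0 ky mE volE volEC volEE} => //; lra.
- by case: gap {q y y0 ky mE volE volEC volEE}; lra.
- by case: gap {q y y0 ky mE volE volEC volEE}; lra.
- move=> x x01; case: gap {q y y0 ky mE volE volEC volEE}.
    exact: separated_gap.
  exact: separated_annulus.
rewrite lerD2l card_balanced.
have bin0 : 0 < 'C(m.*2, m)%:R :> R by rewrite ltr0n bin_gt0 -addnn leq_addr.
rewrite mulrAC ler_pM2r ?invr_gt0 ?exprn_gt0// -mulrA ler_pM2l// ler_pdivrMr//.
by rewrite -natrX -natrM ler_nat expn2_le_central_bin.
Qed.

(** * Asymptotics *)

Lemma expR_ge_id (R : realType) (x : R) : x <= expR x.
Proof. by have := expR_ge1Dx x; lra. Qed.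

Lemma expRN_le_inv (R : realType) (x : R) : 0 < x -> expR (- x) <= x^-1.
Proof. by move=> x0; rewrite expRN lef_pV2 ?posrE ?expR_gt0// expR_ge_id. Qed.

(** Invert [1 + w <= expR w] at [w = z / (1 - z)], where [1 + w] is [(1 - z)^-1]. *)
Lemma expR_le_onem (R : realType) (z : R) : z < 1 -> expR (- (z / (1 - z))) <= 1 - z.
Proof.
move=> z1; rewrite expRN -[leRHS]invrK lef_pV2 ?posrE ?expR_gt0 ?invr_gt0 ?subr_gt0//.
apply: le_trans (expR_ge1Dx _).
by rewrite le_eqVlt; apply/orP; left; apply/eqP; field; lra.
Qed.

Lemma expR_half_le2 (R : realType) : expR (2^-1 : R) <= 2.
Proof.
rewrite -[leRHS]invrK -[leLHS]invrK -expRN lef_pV2 ?posrE ?expR_gt0 ?invr_gt0//.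
by have := expR_ge1Dx (- 2^-1 : R); lra.
Qed.

Lemma truncn_bounds (R : realType) (z : R) : 0 <= z ->
  (Num.truncn z)%:R <= z /\ z - 1 <= (Num.truncn z)%:R.
Proof. by move=> /truncn_itv; rewrite -natr1 => /andP[? ?]; split; lra. Qed.

(* Here x stands for ln n, so that r = x / n is at most 4 / x. *)
Lemma correct_bound_asymp (R : realType) (a c eps : R) :
  0 < a -> 0 < c -> c < 1 -> 0 < eps ->
  exists C X0 : R, forall (n : nat) (x q : R), (0 < n)%N -> expR x = n%:R -> X0 <= x ->
  q <= c * x / n%:R ->
  let rs := a * x / n%:R in let tau := eps * x / n%:R in
  exists M k : nat,
   let y := M%:R * (1 - q) ^+ n in
   [/\ M.+1%:R * (rs + rs + tau) <= 1 - rs, 0 < y, k%:R <= y / 4, 0 < x &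
    4 / y + 4 * (1 - tau) ^+ n + 2 * n.+1%:R / 2 ^+ k <= C / x].
Proof.
move=> a0 c0 c1 eps0.
pose L := a + a + eps.
have L0 : 0 < L by rewrite /L; lra.
(* The slack between [c] and [c'] absorbs the error in replacing [(1 - q) ^+ n] by an
   exponential. *)
pose c' := (1 + c) / 2.
have cc' : c < c' by rewrite /c'; lra.
have c'0 : 0 < c' by lra.
(* Chosen so that [kappa * x ^+ 2 <= y]: 24 is the 6 of the cubic exponential term times the 4 lost
   in [M]. *)
pose kappa := (1 - c') ^+ 3 / (24 * L).
have kappa0 : 0 < kappa by rewrite divr_gt0 ?exprn_gt0 ?mulr_gt0//; rewrite /c'; lra.
(* One summand for each of the three error terms; the threshold after it adds up all lower bounds
   required of [x]. *)
exists (4 / kappa + 4 / eps + 4).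
exists (1 + 20 / kappa + 8 * (L + a) + 16 * L + 4 * c * c' / (c' - c) + 4 * eps).
move=> n x q n0 xn Xx qle rs tau.
have [x1 [kx [x2 [x3 [x4 x5]]]]] : 1 <= x /\ 20 / kappa <= x /\
    8 * (L + a) <= x /\ 16 * L <= x /\ 4 * c * c' / (c' - c) <= x /\ 4 * eps <= x.
  have : 0 <= 20 / kappa by rewrite divr_ge0// ltW.
  have : 0 <= 4 * c * c' / (c' - c) by rewrite divr_ge0 ?mulr_ge0//; lra.
  by repeat split; lra.
have x0 : 0 < x by lra.
have nR0 : 0 < n%:R :> R by rewrite ltr0n.
pose r := x / n%:R.
have r0 : 0 < r by rewrite divr_gt0.
have rn : r * n%:R = x by rewrite /r divfK ?gt_eqF.
have rx : r * x <= 4.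
  rewrite /r mulrAC ler_pdivrMr// -xn.
  have := expR_ge1Dxn 1 (ltW x0); rewrite (_ : 2`!%:R = 2 :> R)//.
  by have := expR_gt0 x; lra.
have rsE : rs = a * r by rewrite /rs /r mulrA.
have tauE : tau = eps * r by rewrite /tau /r mulrA.
have {}qle : q <= c * r by rewrite /r mulrA.
have small B : 0 <= B -> B * 4 <= x -> B * r <= 1.
  move=> B0 Bx; rewrite -(ler_pM2r x0) mul1r -mulrA; apply: le_trans Bx.
  exact: ler_wpM2l.
have r1 : 2 * (L + a) * r <= 1 by apply: small; lra.
have r2 : 4 * L * r <= 1 by apply: small; lra.
have r3 : c * c' / (c' - c) * r <= 1.
  apply: small; last by apply: le_trans x4; rewrite -[4 * c]mulrC -[c * 4 * c']mulrAC; lra.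
  by rewrite divr_ge0 ?mulr_ge0//; lra.
have {}r3 : c * c' * r <= c' - c.
  have d0 : 0 < c' - c by lra.
  by move: r3; rewrite mulrAC ler_pdivrMr// mul1r.
have r4 : eps * r <= 1 by apply: small; lra.
have Lr0 : 0 < L * r by rewrite mulr_gt0.
(* With [M] the integer part of [z], the [M] blocks fill at most half of [0, 1], which leaves room
   for one more block and a margin [rs]. *)
pose z := (2 * (L * r))^-1.
have zE : z * (L * r) = 2^-1 by rewrite /z invfM divfK// gt_eqF.
have z0 : 0 < z by rewrite invr_gt0; lra.
have z2 : 2 <= z by rewrite -(ler_pM2r Lr0) zE; lra.
have [Mz zM] := truncn_bounds (ltW z0).
set M := Num.truncn z in Mz zM.
pose y := M%:R * (1 - q) ^+ n.
have [cr1 qcr] : c * r < 1 /\ 1 - c * r <= 1 - q.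
  split; last lra.
  by rewrite -(ltr_pM2r c'0); nra.
have powq : expR (- (c' * x)) <= (1 - q) ^+ n.
  apply: le_trans (_ : _ <= (1 - c * r) ^+ n) _; last first.
    by apply: lerXn2r; rewrite ?nnegrE; lra.
  apply: le_trans (_ : _ <= expR (- (c * r / (1 - c * r))) ^+ n) _; last first.
    by apply: lerXn2r; rewrite ?nnegrE ?expR_ge0 ?expR_le_onem//; lra.
  rewrite -expRM_natr ler_expR mulNr lerN2.
  rewrite (_ : _ * n%:R = c * x / (1 - c * r)); last first.
  by rewrite mulrAC -[c * r * _]mulrA rn.
  rewrite ler_pdivrMr; last lra.
  by rewrite mulrAC ler_pM2r//; lra.
have ylow : kappa * x ^+ 2 <= y.
  have Mlow : 1 <= M%:R * (4 * (L * r)).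
    have : z / 2 * (L * r) <= M%:R * (L * r) by rewrite ler_pM2r//; lra.
    by rewrite mulrAC zE; lra.
  have ylow1 : expR (- (c' * x)) <= y * (4 * (L * r)).
    apply: le_trans powq _; rewrite /y mulrAC -[leLHS]mul1r ler_wpM2r//.
    by apply: exprn_ge0; lra.
  (* Multiply by [n = expR x]; the cubic term of the exponential then beats the factor [x] on the
     right. *)
  have : expR ((1 - c') * x) <= y * (4 * L * x).
    rewrite mulrBl mul1r expRD xn mulrC -ler_pdivlMr//.
    by apply: le_trans ylow1 _; rewrite /r !mulrA.
  have cx0 : 0 <= (1 - c') * x by rewrite mulr_ge0//; rewrite /c'; lra.
  move/(le_trans (le_trans _ (expR_ge1Dxn 2 cx0))) => /(_ (((1 - c') * x) ^+ 3 / 6)).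
  have -> : (3`!%:R : R) = 6 by [].
  rewrite lerDr ler01 => /(_ isT) H.
  rewrite -(ler_pM2r (_ : 0 < 4 * L * x)); last by rewrite !mulr_gt0.
  apply: le_trans H; rewrite le_eqVlt; apply/orP; left; apply/eqP.
  by rewrite /kappa; field; rewrite gt_eqF.
have y0 : 0 < y by apply: lt_le_trans ylow; rewrite mulr_gt0 ?exprn_gt0.
have y40 : 0 <= y / 4 by lra.
have [ky yk] := truncn_bounds y40.
set k := Num.truncn (y / 4) in ky yk.
exists M, k; split => //.
  rewrite rsE tauE -natr1 (_ : a * r + a * r + eps * r = L * r); last by rewrite /L; ring.
  have : M%:R * (L * r) <= 2^-1 by rewrite -zE ler_pM2r.
  nra.
rewrite -/y.
have kxy : kappa * x <= y.
  apply: le_trans ylow; rewrite ler_pM2l// expr2; nra.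
have t1 : 4 / y <= 4 / kappa / x.
  by rewrite -[_ / kappa / x]mulrA -invfM ler_pM2l// lef_pV2 ?posrE// mulr_gt0.
have t2 : 4 * (1 - tau) ^+ n <= 4 / eps / x.
  rewrite -[_ / eps / x]mulrA -invfM ler_pM2l//.
  apply: le_trans (expRN_le_inv _); last by rewrite mulr_gt0.
  rewrite (_ : eps * x = tau * n%:R); last by rewrite /tau divfK ?gt_eqF.
  rewrite -[- (tau * _)]mulNr expRM_natr; apply: lerXn2r; rewrite ?nnegrE ?expR_ge0//.
    by rewrite tauE; lra.
  by have := expR_ge1Dx (- tau); lra.
have t3 : 2 * n.+1%:R / 2 ^+ k <= 4 / x.
  have n1 : n.+1%:R <= 2 * n%:R :> R by rewrite -natrM ler_nat mul2n -addnn -addn1 leq_add2l.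
  (* [20 * x <= y] gives [k >= 4 * x], hence [2 ^+ k >= n ^+ 2], which beats the polynomial
     factor. *)
  have two_k : expR (x + x) <= 2 ^+ k :> R.
    apply: le_trans (_ : _ <= expR 2^-1 ^+ k) _; last first.
      by apply: lerXn2r; rewrite ?nnegrE ?expR_ge0 ?expR_half_le2.
    rewrite -expRM_natr ler_expR.
    have : 20 * x <= y.
      apply: le_trans ylow; rewrite expr2 mulrA ler_pM2r//.
      by rewrite mulrC -ler_pdivrMr.
    lra.
  rewrite ler_pdivrMr ?exprn_gt0//.
  apply: le_trans (_ : _ <= 4 / x * expR (x + x)) _; last first.
    by rewrite ler_pM2l// divr_gt0.
  rewrite expRD xn mulrA -mulrA mulrC.
  have : 1 <= x^-1 * n%:R by rewrite mulrC ler_pdivlMr// mul1r -xn expR_ge_id.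
  nra.
by rewrite !mulrDl; lra.
Qed.

(** * Choice of the constants and passage to the limit *)

Theorem theorem7 (R : realType) (a b : R) (hb : 0 <= b) (hab : b < a)
    (h : a - b < 2^-1 \/ a < 1)
    (d dS : nat -> measure_display)
    (T : forall m : nat, measurableType (d m))
    (P : forall m : nat, probability (T m) R)
    (S : forall m : nat, measurableType (dS m))
    (X : forall m : nat, 'I_(m.*2) -> {RV (P m) >-> R})
    (V1 : forall m : nat, T m -> {set 'I_(m.*2)})
    (W : forall m : nat, {RV (P m) >-> (S m)})
    (hmodel : forall m : nat, gbm_randomness (@X m) (@V1 m) (W m))
    (A : forall m : nat, graph m.*2 -> S m -> {set {set 'I_(m.*2)}})
    (hA : forall m : nat, measurable_algorithm (@A m)) :
  (fun m : nat =>
     let n : R := (m.*2)%:R in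
     P m [set w | A m (gbm_graph (a * ln n / n) (b * ln n / n)
                         (fun u => X m u w) (V1 m w)) (W m w)
                  <> parts (V1 m w)]) @ \oo --> 1%E.
Proof.
have a0 : 0 < a by exact: le_lt_trans hab.
have [gap [c [eps [c0 c1 eps0 qc]]]] : exists (gap : bool) (c eps : R),
    [/\ 0 < c, c < 1, 0 < eps & forall z, 0 <= z ->
    (if gap then a * z else 2 * (a * z + eps * z - Num.max (eps * z) (b * z))) <= c * z].
  case: h => [h1|h1]; last by exists true, a, 1; split.
  (* [eps] is half the slack in [a - b < 2^-1], so the annulus constant [2 * (a - b + eps)] equals
     [a - b + 2^-1], still below 1. *)
  exists false, (a - b + 2^-1), ((2^-1 - (a - b)) / 2); split; try lra.
  move=> z z0; set e := (_ / 2).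
  have : b * z <= Num.max (e * z) (b * z) by rewrite le_max lexx orbT.
  rewrite /e; lra.
have [C [X0 asymp]] := correct_bound_asymp a0 c0 c1 eps0.
pose correct m := [set w | A m (gbm_graph (a * ln m.*2%:R / m.*2%:R)
  (b * ln m.*2%:R / m.*2%:R) (fun u => X m u w) (V1 m w)) (W m w) = parts (V1 m w)].
have mcorrect m : measurable (correct m) by exact: (measurable_correct (hmodel m)).
have bound m : (0 < m)%N -> X0 <= ln m.*2%:R -> 0 < ln (m.*2%:R : R) ->
    fine (P m (correct m)) <= C / ln m.*2%:R.
  move=> m0 Xm x0; have n0 : (0 < m.*2)%N by rewrite double_gt0.
  pose x : R := ln m.*2%:R; pose n : R := m.*2%:R.
  have nn : 0 < n by rewrite ltr0n.
  pose q := if gap then a * x / n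
    else 2 * (a * x / n + eps * x / n - Num.max (eps * x / n) (b * x / n)).
  have qle : q <= c * x / n.
    by rewrite /q -!mulrA; apply: qc; rewrite divr_ge0// ltW.
  have [|M [k [M_le y0 ky _ le_C]]] := asymp m.*2 x q n0 _ Xm qle.
    by rewrite lnK// posrE.
  apply: le_trans le_C.
  have xn0 : 0 < x / n by rewrite divr_gt0.
  apply: (prob_correct_cells_le (gap := gap) (M := M) (hmodel m) (hA m)) => //.
  - by rewrite -mulrA mulr_ge0 // ltW.
  - by rewrite -!mulrA ler_pM2r // ltW.
  - by rewrite -mulrA mulr_gt0.
rewrite /= (_ : (fun m => _) = EFin \o (fun m => 1 - fine (P m (correct m)))); last first.
  apply/funext => m /=; rewrite EFinB fine_probK// -probability_setC//.
apply: cvg_EFin; first by near=> m.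
apply/cvgrPdist_le => e e0; near=> m.
(* The threshold makes [ln n] exceed 1, [X0] and [C / e] together. *)
have n_big : expR (Num.max 1 (Num.max X0 (C / e))) <= m%:R by near: m; exact: nbhs_infty_ger.
have m0 : (0 < m)%N by rewrite -(ltr_nat R); apply: lt_le_trans n_big; exact: expR_gt0.
have : Num.max 1 (Num.max X0 (C / e)) <= ln m.*2%:R.
  rewrite -ler_expR lnK ?posrE ?ltr0n ?double_gt0//; apply: le_trans n_big _.
  by rewrite ler_nat -addnn leq_addr.
rewrite !ge_max => /and3P[ln1 lnX lnC].
have ln0 : 0 < ln (m.*2%:R : R) by apply: lt_le_trans ln1.
rewrite /= subKr ger0_norm ?fine_prob_ge0//.
apply: le_trans (bound m m0 lnX ln0) _.
by rewrite ler_pdivrMr// mulrC -ler_pdivrMr.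
Unshelve. all: by end_near.
Qed.
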